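(* Let $X$ be a separable metric space and $f:X\to X$ a continuous map. Let $Z\subseteq X$ be closed and internally chain transitive. Then there exists an asymptotic pseudo-orbit $\langle x_i\rangle_{i\in\omega}$ of $f$, with $x_i\in Z$ for all $i$, such that $\omega\langle x_i\rangle=Z$.
   Context: Let $\omega=\{0,1,2,\dots\}$ and let $d$ be the metric on $X$. An asymptotic pseudo-orbit of $f$ is a sequence $\langle x_i\rangle_{i\in\omega}$ in $X$ with $d(f(x_i),x_{i+1})\to0$ as $i\to\infty$. For a sequence $\langle x_i\rangle$ in $X$, $\omega\langle x_i\rangle=\bigcap_{N\in\omega}\overline{\{x_i:i\ge N\}}$. For $\delta>0$, a $\delta$-chain from $a$ to $b$ is a finite sequence $x_0,x_1,\dots,x_n$ with $x_0=a$, $x_n=b$ and $d(f(x_i),x_{i+1})<\delta$ for all $i<n$. A set $A\subseteq X$ is internally chain transitive (ICT) if for all $a,b\in A$ and all $\delta>0$ there is a $\delta$-chain from $a$ to $b$ consisting of elements of $A$.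
   Formalization: Z is assumed nonempty (the claim fails for the empty set), and δ-chains must have at least one step, n ≥ 1 (with n = 0 allowed, every singleton would be internally chain transitive and the claim fails for a non-fixed point). *)

(* Defs.v *)
From HB Require Import structures.
From mathcomp Require Import all_boot all_order all_algebra.
From mathcomp Require Import boolp classical_sets cardinality reals topology.
Set Implicit Arguments.
Unset Strict Implicit.
Unset Printing Implicit Defensive.
Import Order.TTheory GRing.Theory Num.Theory.
Import numFieldTopology.Exports.
Local Open Scope classical_set_scope.
Local Open Scope ring_scope.

Definition separable (X : topologicalType) : Prop :=
  exists D : set X, countable D /\ dense D.

Definition asymptotic_pseudo_orbit (R : realType) (X : metricType R)
    (f : X -> X) (x : nat -> X) : Prop :=
  mdist (f (x i)) (x i.+1) @[i --> \oo] --> (0 : R).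

Definition omega_limit (X : topologicalType) (x : nat -> X) : set X :=
  \bigcap_(N in [set: nat]) closure [set x i | i in [set i | (N <= i)%N]].

(* The chain from [a] to [b] is [x 0, ..., x n]; values of [x] beyond [n] are
   irrelevant.  Chains make at least one step ([0 < n]): if [n = 0] were
   allowed, every singleton would be internally chain transitive, even one
   whose point is not fixed by [f]. *)
Definition delta_chain_in (R : realType) (X : metricType R) (f : X -> X)
    (A : set X) (delta : R) (a b : X) : Prop :=
  exists (n : nat) (x : nat -> X),
    [/\ (0 < n)%N, x 0%N = a, x n = b,
        forall i, (i < n)%N -> mdist (f (x i)) (x i.+1) < delta
      & forall i, (i <= n)%N -> A (x i)].

Definition internally_chain_transitive (R : realType) (X : metricType R)
    (f : X -> X) (A : set X) : Prop :=
  forall a b, A a -> A b ->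
  forall delta : R, 0 < delta -> delta_chain_in f A delta a b.

(* Main.v *)
(** A countable dense subset of [Z], enumerated so that each of its points
    recurs infinitely often, gives a sequence [z] in [Z] with
    [Z `<=` omega_limit z].  Joining [z k] to [z k.+1] by a [k.+1^-1]-chain in
    [Z] and concatenating these chains yields the pseudo-orbit; since [Z] is
    closed, its omega-limit set stays in [Z]. *)
Require Import Defs.
From HB Require Import structures.
From mathcomp Require Import all_boot all_order all_algebra.
From mathcomp Require Import boolp classical_sets cardinality reals topology.
From mathcomp Require Import interval_inference num_normedtype.
Import Order.TTheory GRing.Theory Num.Theory.
Import numFieldTopology.Exports.
Local Open Scope classical_set_scope.
Local Open Scope ring_scope.

Lemma separable_dense_seq (R : realType) (X : metricType R) (A : set X) :
  separable X -> A !=set0 ->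
  exists z : nat -> X, (forall n, A (z n)) /\ A `<=` closure (range z).
Proof.
move=> [D [/countable_injP [h hinj] dD]] [a0 Aa0].
(* [D] may miss [A]: the witness for the code of [(k, m)] is a point of [A]
   within [m.+1^-1] of the [k]-th point of [D]. *)
pose Q n y := A y /\ exists d k m,
  [/\ D d, h d = k, unpickle n = Some (k, m) & mdist d y < m.+1%:R^-1].
have /choice [z zP] : forall n, exists y, A y /\ ((exists y', Q n y') -> Q n y).
  move=> n; have [[y Qy]|nQ] := pselect (exists y, Q n y).
    by exists y; split => //; case: Qy.
  by exists a0; split => // /nQ.
exists z; split=> [n|a Aa B]; first by have [] := zP n.
rewrite -nbhs_ballE => -[e /= e0 eB].
have [m me] : exists m, (m.+1%:R^-1 : R) < e / 2.
  have [N _ NP] := near_infty_natSinv_lt (PosNum (divr_gt0 e0 (@ltr0Sn R 1))).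
  by exists N; exact: (NP N (leqnn N)).
have m0 : 0 < (m.+1%:R^-1 : R) by rewrite invr_gt0 ltr0Sn.
have [d [ad Dd]] : (interior (ball a m.+1%:R^-1) `&` D) !=set0.
  apply: dD; last exact: open_interior.
  by exists a; exact: nbhsx_ballx.
have {}ad : mdist a d < m.+1%:R^-1.
  by move/interior_subset: ad; rewrite ballEmdist.
have [_ Qz] := zP (pickle (h d, m)).
have [|_ [d' [k [m' [Dd' hd']]]]] := Qz.
  exists a; split=> //; exists d, (h d), m; split; rewrite ?pickleK //.
  by rewrite metric_sym.
rewrite pickleK => -[hk <-] d'z.
have dd' : d' = d by apply: hinj; rewrite ?inE // hd'.
exists (z (pickle (h d, m))); split; first by exists (pickle (h d, m)).
apply: eB; rewrite ballEmdist /=.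
apply: (le_lt_trans (@metric_triangle _ _ a d _)).
rewrite [e]splitr; apply: ltrD; first exact: lt_trans ad me.
by apply: (lt_trans _ me); rewrite dd' in d'z.
Qed.

Lemma separable_recurrent_seq (R : realType) (X : metricType R) (A : set X) :
  separable X -> A !=set0 ->
  exists z : nat -> X, (forall n, A (z n)) /\ A `<=` omega_limit z.
Proof.
move=> sepX A0; have [z [Az dz]] := separable_dense_seq _ _ _ sepX A0.
exists (z \o logn 2); split=> [n|a Aa N _ B /(dz a Aa)]; first exact: Az.
move=> [_ [[k _ <-] Bzk]]; exists (z k); split => //.
have nE : logn 2 (2 ^ k * N.*2.+1) = k.
  by rewrite lognM ?expn_gt0 // pfactorK // lognE dvdn2 /= odd_double addn0.
exists (2 ^ k * N.*2.+1)%N; rewrite /= ?nE //.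
rewrite (@leq_trans N.*2.+1) ?leq_pmull ?expn_gt0 //.
by rewrite -addnn leqW // leq_addr.
Qed.

Lemma concat_blocks (T : Type) (L : nat -> nat) (c : nat -> nat -> T) :
  (forall k, (0 < L k)%N) -> (forall k, c k (L k) = c k.+1 0%N) ->
  exists (x : nat -> T) (b : nat -> nat),
    [/\ forall n, exists j, [/\ (j < L (b n))%N, x n = c (b n) j
                              & x n.+1 = c (b n) j.+1],
        forall K, \forall n \near \oo, (K <= b n)%N
      & forall K, exists2 n, (K <= n)%N & x n = c K 0%N].
Proof.
move=> L0 cL.
pose step (s : nat * nat) :=
  if (s.2.+1 < L s.1)%N then (s.1, s.2.+1) else (s.1.+1, 0%N).
pose s n := iter n step (0%N, 0%N).
have sL n : ((s n).2 < L (s n).1)%N.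
  by elim: n => [|n IH] /=; [exact: L0 | rewrite /step; case: ifP].
have s_le n : ((s n).1 <= n)%N.
  by elim: n => //= n IH; rewrite /step; case: ifP => _ //=; exact: leqW.
have s_mono m n : (m <= n)%N -> ((s m).1 <= (s n).1)%N.
  elim: n => [|n IH]; first by rewrite leqn0 => /eqP ->.
  rewrite leq_eqVlt => /predU1P[->//|/IH /leq_trans]; apply => /=.
  by rewrite /step; case: ifP.
have start K : exists n, s n = (K, 0%N).
  elim: K => [|K [n sn]]; first by exists 0%N.
  have run j : (j < L K)%N -> s (n + j)%N = (K, j).
    elim: j => [|j IH] jL; first by rewrite addn0.
    by rewrite addnS /= IH 1?ltnW // /step /= jL.
  exists (n + (L K).-1).+1; rewrite /= run ?prednK // /step /= prednK //.
  by rewrite ltnn.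
exists (fun n => c (s n).1 (s n).2), (fun n => (s n).1); split=> [n|K|K].
- exists (s n).2; split => //=; rewrite /step; case: ifPn => //= sn.
  by rewrite -cL; congr c; apply/eqP; rewrite eqn_leq sL andbT leqNgt.
- have [m sm] := start K; exists m => // n /= /s_mono.
  by rewrite sm.
- have [n sn] := start K; exists n; rewrite ?sn //.
  by have := s_le n; rewrite sn.
Qed.

Theorem lemma15 (R : realType) (X : metricType R) (f : X -> X) (Z : set X)
    (sepX : separable X) (cf : continuous f) (cZ : closed Z)
    (Z0 : Z !=set0) (ictZ : internally_chain_transitive f Z) :
  exists x : nat -> X,
    [/\ asymptotic_pseudo_orbit f x, forall i, Z (x i) & omega_limit x = Z].
Proof.
have [z [Zz dz]] := separable_recurrent_seq _ _ _ sepX Z0.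
have /choice [L /choice [c cP]] : forall k,
    delta_chain_in f Z k.+1%:R^-1 (z k) (z k.+1).
  by move=> k; apply: ictZ => //; rewrite invr_gt0 ltr0Sn.
have [|k|x [b [xP bP zP]]] := @concat_blocks X L c.
- by move=> k; have [] := cP k.
- by have [_ _ -> _ _] := cP k; have [_ -> _ _ _] := cP k.+1.
have Zx n : Z (x n).
  have [j [jL -> _]] := xP n; have [_ _ _ _] := cP (b n).
  by apply; exact: ltnW.
exists x; split => //.
  apply/cvg_ballP => e e0.
  have [N _ NP] := near_infty_natSinv_lt (PosNum e0).
  apply: filterS (bP N) => n Nb; have [j [jL -> ->]] := xP n.
  have [_ _ _ /(_ j jL) lt_j _] := cP (b n).
  rewrite /ball /= sub0r normrN ger0_norm ?mdist_ge0 //.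
  exact: lt_trans lt_j (NP _ Nb).
apply/seteqP; split=> [a /(_ 0%N I) cxa|a Za N _ B /(dz a Za N I)].
  rewrite ((closure_id Z).1 cZ); move: a cxa.
  by apply: closure_subset => _ [n _ <-]; exact: Zx.
move=> [_ [[k Nk <-] Bzk]]; have [n kn xn] := zP k.
exists (z k); split => //; exists n; first exact: leq_trans Nk kn.
by rewrite xn; have [_ -> _ _ _] := cP k.
Qed.
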